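(* Let $E$ be a nonzero real Banach space and $S\colon E\rightrightarrows E^*$ be closed and monotone. Then the following are equivalent: (a) $S$ is quasidense; (b) for all $w\in E$, all nonempty $w(E^*,E)$-compact convex subsets $\widetilde W$ of $E^*$ and all $\eta>0$, there exists $(s,s^* )\in G(S)$ such that $\tfrac12\|s-w\|^2+\tfrac12\operatorname{dist}(s^*,\widetilde W)^2+\max_{x^*\in\widetilde W}\langle s-w,s^*-x^*\rangle<\eta$.
   Context: For a multifunction $S\colon E\rightrightarrows E^*$ with nonempty graph $G(S)$: closed means $G(S)$ norm-closed; monotone means $\langle s-t,s^*-t^*\rangle\ge0$ on $G(S)$; quasidense means for every $(x,x^* )\in E\times E^*$, $\inf_{(s,s^* )\in G(S)}[\tfrac12\|s-x\|^2+\tfrac12\|s^*-x^*\|^2+\langle s-x,s^*-x^*\rangle]\le0$. $\operatorname{dist}$ is norm distance in $E^*$. *)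

(* Defs.v *)
From HB Require Import structures.
From mathcomp Require Import all_boot all_order all_algebra.
From mathcomp Require Import all_classical all_reals all_analysis.
Set Implicit Arguments. Unset Strict Implicit. Unset Printing Implicit Defensive.
Import Order.TTheory GRing.Theory Num.Theory.
Import numFieldNormedType.Exports.
Local Open Scope classical_set_scope.
Local Open Scope ring_scope.

Definition is_dual {R : realType} {E : normedModType R} (f : E -> R) : Prop :=
  (forall (a : R) (x y : E), f (a *: x + y) = a * f x + f y) /\ continuous f.

Definition dnorm {R : realType} {E : normedModType R} (f : E -> R) : R :=
  sup [set `|f x| | x in [set x : E | `|x| <= 1]].

Definition dsub {R : realType} {E : normedModType R} (f g : E -> R) : E -> R :=
  fun x => f x - g x.

(* A multifunction S : E => E^* is given by its graph G(S), a subset of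
   E x E^*; we require the second components to lie in E^*. *)
Definition graph_in_dual {R : realType} {E : normedModType R}
  (S : set (E * (E -> R))) : Prop := forall p, S p -> is_dual p.2.

Definition closed_graph {R : realType} {E : normedModType R}
  (S : set (E * (E -> R))) : Prop :=
  forall (x : E) (xs : E -> R), is_dual xs ->
    (forall e : R, 0 < e -> exists p, S p /\ `|p.1 - x| < e /\ dnorm (dsub p.2 xs) < e) ->
    S (x, xs).

Definition monotone_mf {R : realType} {E : normedModType R}
  (S : set (E * (E -> R))) : Prop :=
  forall p q, S p -> S q -> 0 <= dsub p.2 q.2 (p.1 - q.1).

Definition quasidense {R : realType} {E : normedModType R}
  (S : set (E * (E -> R))) : Prop :=
  forall (x : E) (xs : E -> R), is_dual xs ->
    inf [set (2^-1 * `|p.1 - x| ^+ 2 + 2^-1 * dnorm (dsub p.2 xs) ^+ 2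
              + dsub p.2 xs (p.1 - x)) | p in S] <= 0.

Definition ddist {R : realType} {E : normedModType R} (f : E -> R)
  (W : set (E -> R)) : R :=
  inf [set dnorm (dsub f g) | g in W].

(* w(E^*,E)-compactness: the weak* topology on E^* is the topology of
   pointwise convergence on E, i.e. the one induced by {ptws E -> R}. *)
Definition weakstar_compact {R : realType} {E : normedModType R}
  (W : set (E -> R)) : Prop :=
  compact (W : set {ptws E -> R}).

Definition convex_dual {R : realType} {E : normedModType R}
  (W : set (E -> R)) : Prop :=
  forall f g (t : R), W f -> W g -> 0 <= t -> t <= 1 ->
    W (fun x => t * f x + (1 - t) * g x).

(* Main.v *)
Require Import Defs.
From HB Require Import structures.
From mathcomp Require Import all_boot all_order all_algebra.
From mathcomp Require Import all_classical all_reals all_analysis.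
From mathcomp Require Import ring lra.
Import Order.TTheory GRing.Theory Num.Theory.
Import numFieldNormedType.Exports.
Local Open Scope classical_set_scope.
Local Open Scope ring_scope.

(* The substance is (a) => (b); translating the graph, take w = 0.  For each
   single v in W quasidensity provides a point of the graph where
     1/2 |s|^2 + 1/2 |s' - v|^2 + <s, s' - v>
   is small.  A minimax argument over the weak*-compact convex set W replaces
   these points by one convex combination (x, y, A) of triples (s, s', <s, s'>),
   good for all v in W at once.  Applying quasidensity at (x, y) brings us back
   to a point (s, s') of the graph: averaged monotonicity bounds
   <s - x, s' - y> from below by a small negative number, hence (s, s') is close
   to (x, y) in norm and inherits the estimate up to a small error, x and y being
   bounded independently of the accuracy because W is bounded
   (Banach-Steinhaus). *)

(** * Continuous linear functionals, the dual norm and convex combinations *)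

Section Dual.
Context {R : realType} {E : normedModType R}.
Implicit Types (f g : E -> R) (x y : E) (W : set (E -> R)).

Lemma is_dual_linear f : is_dual f -> linear (f : E -> R^o).
Proof. by case=> lf _ a x y; rewrite lf. Qed.

Lemma dualD f x y : is_dual f -> f (x + y) = f x + f y.
Proof. by case=> lf _; have := lf 1 x y; rewrite scale1r mul1r. Qed.

Lemma dual0 f : is_dual f -> f 0 = 0.
Proof. by move=> df; have := dualD f 0 0 df; rewrite addr0; lra. Qed.

Lemma dualZ f (a : R) x : is_dual f -> f (a *: x) = a * f x.
Proof. by move=> df; case: (df) => lf _; have := lf a x 0; rewrite dual0 // !addr0. Qed.

Lemma dualB f x y : is_dual f -> f (x - y) = f x - f y.
Proof. by move=> df; rewrite -scaleN1r dualD // dualZ // mulN1r. Qed.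

Lemma dual_sum f (I : Type) (r : seq I) (l : I -> R) (s : I -> E) :
  is_dual f -> f (\sum_(i <- r) l i *: s i) = \sum_(i <- r) l i * f (s i).
Proof.
move=> df; elim: r => [|i r IH]; first by rewrite !big_nil dual0.
by rewrite !big_cons dualD // dualZ // IH.
Qed.

Lemma is_dual_lincomb f g (a : R) : is_dual f -> is_dual g ->
  is_dual (fun x => a * f x + g x).
Proof.
move=> [lf cf] [lg cg]; split=> [b x y|x]; first by rewrite lf lg; ring.
by apply: cvgD; [apply: cvgM; [exact: cvg_cst|exact: cf]|exact: cg].
Qed.

Lemma is_dual_dsub f g : is_dual f -> is_dual g -> is_dual (dsub f g).
Proof.
move=> df dg; have -> : dsub f g = fun x => -1 * g x + f x.
  by apply/funext => x; rewrite /dsub; ring.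
exact: is_dual_lincomb.
Qed.

Lemma is_dual_sum (I : eqType) (r : seq I) (l : I -> R) (F : I -> E -> R) :
  (forall i, i \in r -> is_dual (F i)) ->
  is_dual (fun x => \sum_(i <- r) l i * F i x).
Proof.
elim: r => [|i r IH] dF.
  under eq_fun do rewrite big_nil.
  by split=> [a x y|x]; [ring|exact: cvg_cst].
under eq_fun do rewrite big_cons.
apply: is_dual_lincomb; first by apply: dF; rewrite mem_head.
by apply: IH => j jr; apply: dF; rewrite inE jr orbT.
Qed.

(** Continuity of a linear functional means boundedness on the unit ball; this makes the supremum in
    [dnorm] a genuine one. *)
Lemma is_dual_bounded f : is_dual f ->
  exists M, forall x, `|x| <= 1 -> `|f x| <= M.
Proof.
move=> df; pose h : {linear E -> R^o} :=
  HB.pack (f : E -> R^o) (GRing.isLinear.Build _ _ _ _ _ (is_dual_linear f df)).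
have /bounded_funP /(_ 1) [M hM] : bounded_near h (nbhs (0 : E)).
  by apply/linear_bounded_continuous; exact: (proj2 df).
by exists M => x /hM.
Qed.

Lemma dnorm_ge f x : is_dual f -> `|x| <= 1 -> `|f x| <= dnorm f.
Proof.
move=> df x1; have [M hM] := is_dual_bounded f df.
by apply: ub_le_sup; [exists M => _ [y y1 <-]; exact: hM|exists x].
Qed.

Lemma dual_norm_ge0 f : is_dual f -> 0 <= dnorm f.
Proof.
by move=> df; apply: le_trans (dnorm_ge f 0 df _); rewrite ?normr_ge0// normr0.
Qed.

Lemma dual_le_dnorm f x : is_dual f -> `|f x| <= dnorm f * `|x|.
Proof.
move=> df; have [->|x0] := eqVneq x 0; first by rewrite dual0 // !normr0 mulr0.
have nx0 : 0 < `|x| by rewrite normr_gt0.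
rewrite -ler_pdivrMr //.
have := dnorm_ge f (`|x|^-1 *: x) df.
rewrite normrZ normfV normr_id mulVf ?gt_eqF // => /(_ (lexx _)).
by rewrite dualZ // normrM normfV normr_id mulrC.
Qed.

Lemma dual_ge_dnorm f x : is_dual f -> - (dnorm f * `|x|) <= f x.
Proof.
by move=> /(dual_le_dnorm f x); rewrite ler_norml => /andP[].
Qed.

Lemma dnorm_le f (M : R) : 0 <= M ->
  (forall x, `|f x| <= M * `|x|) -> dnorm f <= M.
Proof.
move=> M0 hM; apply: ge_sup.
  by exists `|f 0|; exists 0 => //=; rewrite normr0.
move=> _ [x /= x1 <-]; apply: le_trans (hM x) _.
by rewrite -[leRHS]mulr1 ler_wpM2l.
Qed.

Lemma dnorm_dsub_trans f g h : is_dual f -> is_dual g -> is_dual h ->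
  dnorm (dsub f h) <= dnorm (dsub f g) + dnorm (dsub g h).
Proof.
move=> df dg dh; have dfg := is_dual_dsub _ _ df dg; have dgh := is_dual_dsub _ _ dg dh.
apply: dnorm_le => [|x]; first by rewrite addr_ge0 ?dual_norm_ge0.
have -> : dsub f h x = dsub f g x + dsub g h x by rewrite /dsub; ring.
by rewrite mulrDl (le_trans (ler_normD _ _)) // lerD ?dual_le_dnorm.
Qed.

Lemma dnorm_dsub_le f g : is_dual f -> is_dual g ->
  dnorm f <= dnorm (dsub f g) + dnorm g.
Proof.
move=> df dg; have dfg := is_dual_dsub _ _ df dg.
apply: dnorm_le => [|x]; first by rewrite addr_ge0 ?dual_norm_ge0.
have -> : f x = dsub f g x + g x by rewrite /dsub; ring.
by rewrite mulrDl (le_trans (ler_normD _ _)) // lerD ?dual_le_dnorm.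
Qed.

Lemma dnorm_sum (I : eqType) (r : seq I) (l : I -> R) (F : I -> E -> R) :
  (forall i, 0 <= l i) -> (forall i, i \in r -> is_dual (F i)) ->
  dnorm (fun x => \sum_(i <- r) l i * F i x) <= \sum_(i <- r) l i * dnorm (F i).
Proof.
move=> l0 dF; apply: dnorm_le => [|x].
  rewrite big_seq; apply: sumr_ge0 => i ir.
  by apply: mulr_ge0 => //; exact/dual_norm_ge0/dF.
rewrite mulr_suml (le_trans (ler_norm_sum _ _ _)) //.
rewrite big_seq [leRHS]big_seq; apply: ler_sum => i ir.
by rewrite normrM (ger0_norm (l0 i)) -mulrA ler_wpM2l //; exact/dual_le_dnorm/dF.
Qed.

Lemma ddist_le f g W : is_dual f -> (forall h, W h -> is_dual h) -> W g ->
  ddist f W <= dnorm (dsub f g).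
Proof.
move=> df dW Wg; apply: ge_inf; last by exists g.
by exists 0 => _ [h Wh <-]; apply: dual_norm_ge0; apply: is_dual_dsub => //; exact: dW.
Qed.

Lemma ddist_ge0 f W : is_dual f -> (forall h, W h -> is_dual h) -> W !=set0 ->
  0 <= ddist f W.
Proof.
move=> df dW [g Wg]; apply: lb_le_inf; first by exists (dnorm (dsub f g)), g.
by move=> _ [h Wh <-]; apply: dual_norm_ge0; apply: is_dual_dsub => //; exact: dW.
Qed.

Lemma convex_dual_sum W (I : eqType) (r : seq I) (l : I -> R) (F : I -> E -> R) :
  convex_dual W -> (forall i, 0 <= l i) -> (forall i, i \in r -> W (F i)) ->
  \sum_(i <- r) l i = 1 -> W (fun x => \sum_(i <- r) l i * F i x).
Proof.
move=> cW l0 WF l1.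
(* Dividing by the total weight makes induction possible: the tail of the list does not inherit
   total weight 1. *)
suff: W (fun x => (\sum_(i <- r) l i)^-1 * \sum_(i <- r) l i * F i x).
  by rewrite l1; under eq_fun do rewrite invr1 mul1r.
have : 0 < \sum_(i <- r) l i by rewrite l1.
elim: r WF {l1} => [|i r IH] WF; first by rewrite big_nil ltxx.
set T := \sum_(j <- r) l j in IH *; rewrite big_cons -/T => T0.
have Wi : W (F i) by apply: WF; rewrite mem_head.
have {}IH := IH (fun j jr => WF j (@mem_behead _ (i :: r) j jr)).
have Tge0 : 0 <= T by apply: sumr_ge0.
(* A tail of total weight 0 cannot be normalized; its weights all vanish and only [F i] remains. *)
have [T00|Tn0] := eqVneq T 0.
  suff -> : (fun x => (l i + T)^-1 * \sum_(j <- i :: r) l j * F j x) = F i by [].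
  have lr0 j : j \in r -> l j = 0.
    move: T00 => /eqP; rewrite /T psumr_eq0 // => /allP lr0 jr.
    exact/eqP/lr0.
  apply/funext => x; rewrite big_cons big_seq big1 => [|j jr].
    by move: T0; rewrite T00 !addr0 => li0; rewrite mulrA mulVf ?mul1r // gt_eqF.
  by rewrite lr0 // mul0r.
have {Tge0} Tgt0 : 0 < T by rewrite lt_neqAle eq_sym Tn0.
have t0 : 0 <= l i / (l i + T) by rewrite divr_ge0 // ltW.
have t1 : l i / (l i + T) <= 1 by rewrite ler_pdivrMr // mul1r lerDl ltW.
have := cW _ _ _ Wi (IH Tgt0) t0 t1.
congr W; apply/funext => x; rewrite big_cons; field.
by rewrite Tn0 gt_eqF.
Qed.

End Dual.

(** * Scalar inequalities and the minimax argument *)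

Lemma sqr_convex_sum {R : realFieldType} (I : Type) (r : seq I) (l a : I -> R) :
  (forall i, 0 <= l i) -> \sum_(i <- r) l i = 1 ->
  (\sum_(i <- r) l i * a i) ^+ 2 <= \sum_(i <- r) l i * a i ^+ 2.
Proof.
move=> l0 l1.
have [m mE] : exists m, m = \sum_(i <- r) l i * a i by eexists.
(* The variance about the weighted mean [m]; its expansion is the claim. *)
have : 0 <= \sum_(i <- r) l i * (a i - m) ^+ 2.
  by apply: sumr_ge0 => i _; rewrite mulr_ge0 ?sqr_ge0.
have -> : \sum_(i <- r) l i * (a i - m) ^+ 2 =
  \sum_(i <- r) l i * a i ^+ 2 - 2 * m * (\sum_(i <- r) l i * a i)
  + m ^+ 2 * \sum_(i <- r) l i.
  rewrite !mulr_sumr -sumrB -big_split /=; apply: eq_bigr => i _. ring.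
by rewrite l1 -mE; nra.
Qed.

(** Extracts a first-order condition: for positive [a] and [b], the choice [t = a / (a + b)] would
    give [t * b < a]. *)
Lemma le0_of_small {R : realFieldType} (a b : R) :
  (forall t : R, 0 < t -> t <= 1 -> a <= t * b) -> a <= 0.
Proof.
move=> h; rewrite leNgt; apply/negP => a0.
have [b0|b0] := lerP b 0; first by have := h 1 ltr01 (lexx _); lra.
pose t := a / (a + b); have ab : 0 < a + b by lra.
have t0 : 0 < t by rewrite divr_gt0.
have t1 : t <= 1 by rewrite ler_pdivrMr //; lra.
have := h t t0 t1.
have -> : t * b = a * b / (a + b) by rewrite /t; field; rewrite gt_eqF.
by rewrite ler_pdivlMr //; nra.
Qed.

(* The weights come from minimizing over [W] the sum of the squared shortfalls
   [max 0 (e - g i v)]: the first-order condition at a minimizer [v0] says that,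
   weighted by the shortfalls at [v0], the sum of the [g i] is maximal there,
   where it is below [e] times the total weight. *)
Lemma minimax {R : realType} (T : topologicalType) (I : choiceType)
  (D : set I) (W : set T) (g : I -> T -> R) (e : R) :
  W !=set0 -> compact W -> (forall i, D i -> continuous (g i)) ->
  (forall u v (t : R), W u -> W v -> 0 <= t -> t <= 1 ->
    exists2 w, W w & forall i, g i w = t * g i u + (1 - t) * g i v) ->
  (forall v, W v -> exists2 i, D i & g i v < e) ->
  exists (r : seq I) (l : I -> R),
    [/\ forall i, i \in r -> D i, forall i, 0 <= l i, \sum_(i <- r) l i = 1 &
        forall v, W v -> \sum_(i <- r) l i * g i v < e].
Proof.
move=> W0 cW cg convW hW.
(* The sets where [g i < e] are open and cover [W]; by compactness finitely many indices suffice. *)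
have [D' D'D covW] : finite_subset_cover D (fun i => [set v | g i v < e]) W.
  case: (W0) => w0 _.
  pose T' : ptopologicalType := HB.pack T (isPointed.Build T w0).
  move: (cW : @compact T' W); rewrite compact_cover.
  apply=> [i Di|v /hW [i Di gi]]; last by exists i.
  rewrite (_ : [set v | _] = g i @^-1` [set x | x < e]) //.
  by apply: open_comp; [move=> v _; exact: cg|exact: open_lt].
pose r : seq I := finmap.enum_fset D'.
have rD i : i \in r -> D i by move=> /D'D; rewrite inE.
pose t v i : R := Num.max 0 (e - g i v).
have t0 v i : 0 <= t v i by rewrite le_max lexx.
have [v0 /set_mem Wv0 minv0] : exists2 c, c \in W &
    forall v, v \in W -> \sum_(i <- r) t c i ^+ 2 <= \sum_(i <- r) t v i ^+ 2.
  apply: compact_EVT_min => //; apply: continuous_subspaceT => v.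
  elim: r rD => [|i s IH] sD.
    by under eq_fun do rewrite big_nil; exact: cvg_cst.
  under eq_fun do rewrite big_cons.
  apply: cvgD; last by apply: IH => j js; apply: sD; rewrite inE js orbT.
  apply: (@cvg_comp _ _ _ (t ^~ i) (fun x : R => x ^+ 2)); last exact: exprn_continuous.
  apply: (@continuous_max _ _ (fun=> 0) (fun w => e - g i w)); first exact: cvg_cst.
  by apply: cvgB; [exact: cvg_cst|apply: cg; apply: sD; rewrite mem_head].
pose s := \sum_(i <- r) t v0 i.
have [i0 i0r gi0] : exists2 i, i \in r & g i v0 < e by apply: covW.
have ti0 : 0 < t v0 i0 by rewrite lt_max subr_gt0 gi0 orbT.
have s0 : 0 < s.
  rewrite lt_neqAle eq_sym sumr_ge0 ?andbT // /s psumr_eq0 //.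
  by apply/negP => /allP /(_ _ i0r); rewrite gt_eqF.
exists r, (fun i => t v0 i / s); split => //.
- by move=> i; rewrite divr_ge0 // ltW.
- by rewrite -mulr_suml mulfV // gt_eqF.
move=> v Wv.
have opt : \sum_(i <- r) t v0 i * (g i v - g i v0) <= 0.
  apply: (@le0_of_small _ _ (\sum_(i <- r) (g i v - g i v0) ^+ 2)) => a a0 a1.
  have [w Ww gw] := convW v v0 a Wv Wv0 (ltW a0) a1.
  have := minv0 w (mem_set Ww).
  (* Along the segment from [v0] to [v] the squared positive parts lie below a quadratic in [a] that
     agrees with them at [a = 0]. *)
  have : \sum_(i <- r) t w i ^+ 2 <=
      \sum_(i <- r) (t v0 i - a * (g i v - g i v0)) ^+ 2.
    apply: ler_sum => i _; rewrite /t gw.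
    have -> : e - (a * g i v + (1 - a) * g i v0) =
      (e - g i v0) - a * (g i v - g i v0) by ring.
    move: (e - g i v0) (a * (g i v - g i v0)) => b c; rewrite !maxEle.
    case: (lerP 0 (b - c)) => h1; last by rewrite expr0n sqr_ge0.
    by case: (lerP 0 b) => h2 //; nra.
  have -> : \sum_(i <- r) (t v0 i - a * (g i v - g i v0)) ^+ 2 =
     \sum_(i <- r) t v0 i ^+ 2
     - 2 * a * (\sum_(i <- r) t v0 i * (g i v - g i v0))
     + a ^+ 2 * \sum_(i <- r) (g i v - g i v0) ^+ 2.
    by rewrite !mulr_sumr -sumrB -big_split /=; apply: eq_bigr => i _; ring.
  set P := \sum_(i <- r) t v0 i * _; set Q := \sum_(i <- r) (g i v - _) ^+ 2.
  have Q0 : 0 <= Q by apply: sumr_ge0 => i _; exact: sqr_ge0.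
  move=> h1 h2.
  have : 0 <= a * (a * Q - 2 * P) by lra.
  by rewrite pmulr_rge0 // => ?; nra.
have sq0 : 0 < \sum_(i <- r) t v0 i ^+ 2.
  rewrite lt_neqAle eq_sym sumr_ge0 ?andbT => [|i _]; last exact: sqr_ge0.
  rewrite psumr_eq0 => [|i _]; last exact: sqr_ge0.
  by apply/negP => /allP /(_ _ i0r); rewrite gt_eqF // exprn_gt0.
(* Each shortfall is 0 or [e - g i v0]; the positive sum of squares yields the strict inequality. *)
have : \sum_(i <- r) t v0 i * g i v0 = e * s - \sum_(i <- r) t v0 i ^+ 2.
  rewrite mulr_sumr -sumrB; apply: eq_bigr => i _; rewrite /t maxEle.
  by case: ifP => _; ring.
move: opt; under eq_bigr do rewrite mulrBr.
rewrite sumrB => opt eqs.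
under eq_bigr do rewrite mulrAC.
by rewrite -mulr_suml ltr_pdivrMr //; lra.
Qed.

(** * Weak* compactness and uniform boundedness *)

Lemma ptws_eval_continuous {R : realType} {E : normedModType R} (x : E) :
  continuous (fun f : {ptws E -> R} => f x).
Proof. exact: (@proj_continuous E (fun=> R)). Qed.

(** Evaluations send [W] to compact sets of reals, so [W] is pointwise bounded; completeness of [E]
    then gives the uniform bound. *)
Lemma weakstar_compact_bounded {R : realType} {E : completeNormedModType R}
  (W : set (E -> R)) : (forall f, W f -> is_dual f) -> weakstar_compact W ->
  exists2 M, 0 <= M & forall f, W f -> dnorm f <= M.
Proof.
move=> dW cW.
have [||M hM] := @Banach_Steinhauss R E R^o W _ _ 1.
- move=> f /dW df; split; last exact: is_dual_linear.
  pose h : {linear E -> R^o} :=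
    HB.pack (f : E -> R^o) (GRing.isLinear.Build _ _ _ _ _ (is_dual_linear f df)).
  by apply/(@bounded_funP _ _ _ h)/linear_bounded_continuous; exact: (proj2 df).
- move=> x.
  have /compact_bounded [M [_ hM]] :
      compact ((fun f : {ptws E -> R} => f x) @` (W : set {ptws E -> R})).
    apply: (@continuous_compact {ptws E -> R} R _ W) => //.
    exact/continuous_subspaceT/ptws_eval_continuous.
  by exists (M + 1) => f Wf; apply: (hM (M + 1)); [rewrite ltrDl|exists f].
exists (Num.max 0 M); first by rewrite le_max lexx.
move=> f Wf; apply: ge_sup; first by exists `|f 0|; exists 0 => //=; rewrite normr0.
by move=> _ [x /= x1 <-]; rewrite le_max (hM f Wf x x1) orbT.
Qed.

(** * Quasidensity and averages of graph points *)

Section Quasidense.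
Context {R : realType} {E : normedModType R}.
Implicit Types (S : set (E * (E -> R))) (W : set (E -> R)).

(** Shows that the quantities in the quasidensity infimum are bounded below by 0. *)
Lemma young_dual (f : E -> R) (x : E) : is_dual f ->
  0 <= 2^-1 * `|x| ^+ 2 + 2^-1 * dnorm f ^+ 2 + f x.
Proof.
move=> df; have := dual_ge_dnorm f x df; have := sqr_ge0 (`|x| - dnorm f).
by move=> *; nra.
Qed.

Lemma quasidense_approx S (x : E) (xs : E -> R) (e : R) :
  S !=set0 -> quasidense S -> is_dual xs -> 0 < e ->
  exists2 p, S p & 2^-1 * `|p.1 - x| ^+ 2 + 2^-1 * dnorm (dsub p.2 xs) ^+ 2
              + dsub p.2 xs (p.1 - x) < e.
Proof.
move=> [p0 Sp0] qS dxs e0; have := le_lt_trans (qS x xs dxs) e0.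
by move=> /inf_lt [|_ [p Sp <-] pe]; [eexists; exists p0 => //|exists p].
Qed.

(* [A] bounds the largest convex function below the duality pairing on [S] at
   [(x, y)]; the second property says that it exceeds the Fitzpatrick function
   of [S] there. *)
Lemma quasidense_minimax S W (e : R) :
  graph_in_dual S -> S !=set0 -> monotone_mf S -> quasidense S ->
  (forall f, W f -> is_dual f) -> W !=set0 -> weakstar_compact W ->
  convex_dual W -> 0 < e ->
  exists (x : E) (y z : E -> R) (A : R), [/\ is_dual y, W z,
    forall v, W v ->
      A - v x + 2^-1 * `|x| ^+ 2 + 2^-1 * dnorm (dsub y z) ^+ 2 < e &
    forall p, S p -> 0 <= p.2 p.1 - y p.1 - p.2 x + A].
Proof.
move=> dS S0 mS qS dW W0 cW convW e0.
(* Pairing each graph point with its own element of [W] keeps [v] out of the norm term: [g j] is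
   affine and weak* continuous in [v]. *)
pose D := [set j : (E * (E -> R)) * (E -> R) | S j.1 /\ W j.2].
pose c (j : (E * (E -> R)) * (E -> R)) : R :=
  j.1.2 j.1.1 + 2^-1 * `|j.1.1| ^+ 2 + 2^-1 * dnorm (dsub j.1.2 j.2) ^+ 2.
pose g (j : (E * (E -> R)) * (E -> R)) (v : {ptws E -> R}) : R := c j - v j.1.1.
have [j Dj|u v t Wu Wv t0 t1|v Wv|r [l [rD l0 l1 hr]]] :=
  @minimax R {ptws E -> R} _ D W g e W0 cW.
- move=> v.
  apply: (@continuous_comp {ptws E -> R} R R (fun f => f j.1.1) (fun y => c j - y)).
    exact: ptws_eval_continuous.
  by apply: cvgB; [exact: cvg_cst|exact: cvg_id].
- exists (fun x => t * u x + (1 - t) * v x); first exact: convW.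
  by move=> j; rewrite /g; ring.
(* At the index [(p, v)], [g] evaluated at [v] is the quasidensity expression at [(0, v)]. *)
- have [p Sp hp] := quasidense_approx S 0 v e S0 qS (dW v Wv) e0.
  exists (p, v) => //; move: hp; rewrite /g /c /= /dsub subr0; lra.
have rS j : j \in r -> S j.1 by move=> /rD [].
have rW j : j \in r -> W j.2 by move=> /rD [].
have dr1 j : j \in r -> is_dual j.1.2 by move=> /rS; exact: dS.
exists (\sum_(j <- r) l j *: j.1.1), (fun u => \sum_(j <- r) l j * j.1.2 u),
  (fun u => \sum_(j <- r) l j * j.2 u), (\sum_(j <- r) l j * j.1.2 j.1.1).
split.
- exact: is_dual_sum.
- exact: convex_dual_sum.
- move=> v Wv; apply: le_lt_trans (hr v Wv).
  rewrite dual_sum; last exact: dW.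
  (* It remains to apply convexity of the squared norms to both averages. *)
  have -> : \sum_(j <- r) l j * g j v =
    \sum_(j <- r) l j * j.1.2 j.1.1 - \sum_(j <- r) l j * v j.1.1
    + 2^-1 * \sum_(j <- r) l j * `|j.1.1| ^+ 2
    + 2^-1 * \sum_(j <- r) l j * dnorm (dsub j.1.2 j.2) ^+ 2.
    rewrite !mulr_sumr -sumrB -!big_split /=; apply: eq_bigr => j _.
    by rewrite /g /c; ring.
  have half0 : (0 : R) <= 2^-1 by rewrite invr_ge0.
  rewrite lerD ?lerD2l // ?ler_wpM2l //.
    rewrite (le_trans _ (sqr_convex_sum _ r l _ l0 l1)) // lerXn2r ?nnegrE //.
      by apply: sumr_ge0 => j _; rewrite mulr_ge0.
    rewrite (le_trans (ler_norm_sum _ _ _)) //; apply: ler_sum => j _.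
    by rewrite normrZ ger0_norm.
  rewrite (le_trans _ (sqr_convex_sum _ r l _ l0 l1)) //.
  have dr j : j \in r -> is_dual (dsub j.1.2 j.2).
    by move=> jr; apply: is_dual_dsub; [exact: dr1|apply: dW; exact: rW].
  have -> : dsub (fun u => \sum_(j <- r) l j * j.1.2 u)
      (fun u => \sum_(j <- r) l j * j.2 u) =
      fun u => \sum_(j <- r) l j * dsub j.1.2 j.2 u.
    apply/funext => u; rewrite /dsub -sumrB; apply: eq_bigr => j _; ring.
  have n0 := dual_norm_ge0 _ (is_dual_sum _ r l (fun j => dsub j.1.2 j.2) dr).
  have nle := dnorm_sum _ r l (fun j => dsub j.1.2 j.2) l0 dr.
  by rewrite lerXn2r ?nnegrE // (le_trans n0 nle).
- move=> p Sp; rewrite dual_sum; last exact: dS.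
  (* Monotonicity between [p] and each chosen graph point, averaged with the weights [l]. *)
  have : 0 <= \sum_(j <- r) l j * dsub p.2 j.1.2 (p.1 - j.1.1).
    rewrite big_seq; apply: sumr_ge0 => j jr.
    by rewrite mulr_ge0 //; apply: mS => //; exact: rS.
  suff -> : \sum_(j <- r) l j * dsub p.2 j.1.2 (p.1 - j.1.1) =
    (\sum_(j <- r) l j) * p.2 p.1 - \sum_(j <- r) l j * j.1.2 p.1
    - \sum_(j <- r) l j * p.2 j.1.1 + \sum_(j <- r) l j * j.1.2 j.1.1.
    by rewrite l1 mul1r.
  rewrite mulr_suml -!sumrB -big_split /= big_seq [RHS]big_seq.
  apply: eq_bigr => j jr; rewrite /dsub.
  rewrite (dualB p.2) ?(dualB j.1.2); [ring|exact: dr1|exact: dS].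
Qed.

End Quasidense.

(** * Quantitative estimates for [w = 0] *)

Lemma quadratic_bound {R : realFieldType} (X Y a b c : R) :
  0 <= c -> X ^+ 2 + Y ^+ 2 <= 2 * (a * X + b * Y + c) ->
  X + Y <= a + b + 2 * (1 + 2 * c + a ^+ 2 + b ^+ 2).
Proof.
move=> c0 h; pose N := 1 + 2 * c + a ^+ 2 + b ^+ 2.
(* Completing squares bounds [(X - a)^2 + (Y - b)^2] by [N]; since [1 <= N], [u^2 <= N] gives
   [u <= N]. *)
have N1 : 1 <= N by have := sqr_ge0 a; have := sqr_ge0 b; rewrite /N; lra.
have hX : (X - a) ^+ 2 <= N by have := sqr_ge0 (Y - b); rewrite /N; nra.
have hY : (Y - b) ^+ 2 <= N by have := sqr_ge0 (X - a); rewrite /N; nra.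
have sq (u : R) : u ^+ 2 <= N -> u <= N by move=> ?; nra.
by have := sq _ hX; have := sq _ hY; rewrite /N; lra.
Qed.

Lemma small_multiple {R : realFieldType} (e C : R) : 0 < e -> 0 < C ->
  exists t : R, [/\ 0 < t, t <= 1 & t * C < e].
Proof.
move=> e0 C0; have eC : 0 < e + C by exact: addr_gt0.
exists (e / (e + C)); split; first by rewrite divr_gt0.
  by rewrite ler_pdivrMr // mul1r lerDl ltW.
by rewrite mulrAC ltr_pdivrMr // mulrDr ltrDr mulr_gt0.
Qed.

Lemma quasidense_fuzzy0 {R : realType} {E : completeNormedModType R}
  (S : set (E * (E -> R))) (W : set (E -> R)) (eta : R) :
  graph_in_dual S -> S !=set0 -> monotone_mf S -> quasidense S ->
  (forall f, W f -> is_dual f) -> W !=set0 -> weakstar_compact W ->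
  convex_dual W -> 0 < eta ->
  exists2 p, S p & 2^-1 * `|p.1| ^+ 2 + 2^-1 * ddist p.2 W ^+ 2
       + sup [set dsub p.2 g p.1 | g in W] < eta.
Proof.
move=> dS S0 mS qS dW W0 cW convW eta0.
have [M M0 hM] := weakstar_compact_bounded W dW cW.
have [[s0 t0] Sp0] := S0.
have dt0 : is_dual t0 := dS _ Sp0.
(* Testing the averaged point against [z] and the fixed graph point [(s0, t0)] gives
   [X^2 + Y^2 <= 2 * (al * X + be * Y + ga)], whence the bound [K], independent of the accuracy. *)
pose al := M + dnorm t0; pose be := `|s0|; pose ga : R := 1 + M * `|s0| + `|t0 s0|.
pose K : R := al + be + 2 * (1 + 2 * ga + al ^+ 2 + be ^+ 2).
have al0 : 0 <= al by rewrite addr_ge0 ?dual_norm_ge0.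
have be0 : 0 <= be by exact: normr_ge0.
have ga0 : 0 <= ga by rewrite !addr_ge0 ?mulr_ge0.
have K0 : 0 <= K.
  by have := sqr_ge0 al; have := sqr_ge0 be; rewrite /K; lra.
(* The final error is at most [tau * C]: the 5 collects 3 errors [e] from the supremum and 2 from
   the squares of [a] and [b]. *)
pose C : R := 5 + 4 * K + 4 * M; have C0 : 0 < C by rewrite /C; lra.
have [tau [tau0 tau1 tauC]] := small_multiple eta C eta0 C0.
have e0 : 0 < tau ^+ 2 by rewrite exprn_gt0.
have e1 : tau ^+ 2 <= 1 by rewrite expr_le1 // ltW.
have [x [y [z [A [dy Wz hA hS]]]]] :=
  quasidense_minimax S W (tau ^+ 2) dS S0 mS qS dW W0 cW convW e0.
have [[s t] Sst] := quasidense_approx S x y (tau ^+ 2) S0 qS dy e0.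
move: hA hS; set e := tau ^+ 2 in e0 e1 *; move=> hA hS /= hst.
have dt : is_dual t := dS _ Sst; have dz := dW z Wz.
have dyz := is_dual_dsub _ _ dy dz; have dty := is_dual_dsub _ _ dt dy.
have X0 := normr_ge0 x; have Y0 := dual_norm_ge0 _ dyz.
have a0 := normr_ge0 (s - x); have b0 := dual_norm_ge0 _ dty.
have yle : dnorm y <= dnorm (dsub y z) + M.
  by apply: le_trans (dnorm_dsub_le _ _ dy dz) _; rewrite lerD2l hM.
set X := `|x| in X0 hA *; set Y := dnorm (dsub y z) in Y0 yle hA *.
set a := `|s - x| in a0 hst *; set b := dnorm (dsub t y) in b0 hst *.
have XYK : X + Y <= K.
  apply: quadratic_bound => //.
  have h1 := hA z Wz; have h2 := hS _ Sp0; rewrite /= in h2.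
  have h3 := dual_ge_dnorm y s0 dy; have h4 := dual_ge_dnorm t0 x dt0.
  have h5 := le_trans (ler_norm _) (dual_le_dnorm z x dz).
  have h6 : dnorm z * `|x| <= M * X by rewrite ler_wpM2r ?hM.
  have h7 := ler_norm (t0 s0).
  have h8 : dnorm y * `|s0| <= (Y + M) * `|s0| by rewrite ler_wpM2r.
  by rewrite -/X in h4 h5 h6 *; rewrite /al /be /ga; lra.
have h1 := hS _ Sst; rewrite /= in h1.
(* Young's inequality for [y - z] at [x] absorbs the two squares. With [h1] this gives
   [dsub t y (s - x) > - e]. *)
have h2 : A - y x < e.
  have := hA z Wz; have := young_dual _ x dyz.
  by rewrite -/X -/Y /dsub; lra.
have pE : dsub t y (s - x) = t s - t x - y s + y x.
  by rewrite /dsub (dualB t) // (dualB y) //; ring.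
have pe : dsub t y (s - x) < e by have := sqr_ge0 a; have := sqr_ge0 b; lra.
have a2 : a <= 2 * tau.
  rewrite -ler_sqr ?nnegrE ?mulr_ge0 ?(ltW tau0) // exprMn -/e.
  by have := sqr_ge0 b; lra.
have b2 : b <= 2 * tau.
  rewrite -ler_sqr ?nnegrE ?mulr_ge0 ?(ltW tau0) // exprMn -/e.
  by have := sqr_ge0 a; lra.
have tyx : dsub t y x <= b * X.
  exact: le_trans (ler_norm _) (dual_le_dnorm _ x dty).
have sX : `|s| <= X + a.
  by rewrite -{1}(subrK x s) addrC; exact: ler_normD.
have dtW : ddist t W <= b + Y.
  exact: le_trans (ddist_le t z W dt dW Wz) (dnorm_dsub_trans _ _ _ dt dy dz).
have dtW0 := ddist_ge0 t W dt dW W0.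
(* Split [<s, t - v>] into [<s - x, t - y> + <x, t - y> + <s - x, y - v> + <x, y - v>]. The last
   term, compared through [A], supplies the negative squares that cancel those of [X] and [Y]. *)
have hsup : sup [set dsub t g s | g in W] <=
    3 * e - 2^-1 * X ^+ 2 - 2^-1 * Y ^+ 2 + (Y + 2 * M) * a + b * X.
  apply: ge_sup; first by exists (dsub t z s), z.
  move=> _ [v Wv <-]; have dv := dW v Wv; have h3 := hA v Wv.
  have h4 : dsub y v (s - x) <= (Y + 2 * M) * a.
    have dyv := is_dual_dsub _ _ dy dv.
    apply: le_trans (ler_norm _) _; apply: le_trans (dual_le_dnorm _ _ dyv) _.
    rewrite ler_wpM2r //; apply: le_trans (dnorm_dsub_trans _ _ _ dy dz dv) _.
    rewrite -/Y lerD2l; apply: dnorm_le => [|u]; first by rewrite mulr_ge0.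
    rewrite /dsub (le_trans (ler_normB _ _)) // mulrDl mul1r mulrDl.
    by rewrite lerD // (le_trans (dual_le_dnorm _ _ _)) // ler_wpM2r ?hM.
  have h5 : dsub y v (s - x) = y s - y x - v s + v x.
    by rewrite /dsub (dualB y) // (dualB v) //; ring.
  have h6 : dsub t v s = t s - v s by [].
  have h7 : dsub t y x = t x - y x by [].
  by rewrite /= h6; lra.
exists (s, t) => //; apply: le_lt_trans tauC; rewrite /=.
have sX2 : `|s| ^+ 2 <= (X + a) ^+ 2.
  by rewrite lerXn2r ?nnegrE ?addr_ge0.
have dt2 : ddist t W ^+ 2 <= (b + Y) ^+ 2.
  by rewrite lerXn2r ?nnegrE ?addr_ge0.
have XY0 : 0 <= X + Y by rewrite addr_ge0.
have aXY : a * (X + Y) <= 2 * tau * K by rewrite ler_pM.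
have bXY : b * (X + Y) <= 2 * tau * K by rewrite ler_pM.
have aM : a * M <= 2 * tau * M by rewrite ler_wpM2r.
have et : e <= tau by rewrite /e expr2 ler_piMl // ltW.
by rewrite /C; lra.
Qed.

(** * Translation to general [w], and the converse through singletons *)

Lemma singleton_weakstar_compact {R : realType} {E : normedModType R} (f : E -> R) :
  weakstar_compact [set f].
Proof. exact: (@compact_set1 {ptws E -> R}). Qed.

Lemma convex_dual_set1 {R : realType} {E : normedModType R} (f : E -> R) :
  convex_dual [set f].
Proof. by move=> _ _ t -> -> _ _; apply/funext => x; ring. Qed.

Lemma subrACA {V : zmodType} (a b c : V) : a + c - (b + c) = a - b.
Proof. by rewrite opprD addrACA subrr addr0. Qed.

Theorem theorem6p1 (R : realType) (E : completeNormedModType R)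
  (S : set (E * (E -> R)))
  (HE : exists x : E, x != 0)
  (HSd : graph_in_dual S) (HSne : S !=set0)
  (HScl : closed_graph S) (HSmon : monotone_mf S) :
  quasidense S <->
  (forall (w : E) (W : set (E -> R)),
     (forall f, W f -> is_dual f) -> W !=set0 ->
     weakstar_compact W -> convex_dual W ->
     forall eta : R, 0 < eta ->
     exists p, S p /\
       2^-1 * `|p.1 - w| ^+ 2 + 2^-1 * ddist p.2 W ^+ 2
       + sup [set dsub p.2 g (p.1 - w) | g in W] < eta).
Proof.
split=> [qS w W dW W0 cW convW eta eta0|h x xs dxs].
  (* Translating the graph by [- w] in [E] preserves monotonicity and quasidensity. *)
  pose S' : set (E * (E -> R)) := [set p | S (p.1 + w, p.2)].
  have S'S p : S p -> S' (p.1 - w, p.2).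
    by case: p => s t Sp; rewrite /S' /= subrK.
  have dS' : graph_in_dual S' by move=> p /HSd.
  have S'0 : S' !=set0 by case: HSne => p /S'S; exists (p.1 - w, p.2).
  have mS' : monotone_mf S'.
    move=> p q Sp Sq; have := HSmon _ _ Sp Sq => /=.
    by rewrite subrACA.
  have qS' : quasidense S'.
    move=> x xs dxs; apply: le_trans (qS (x + w) xs dxs).
    rewrite le_eqVlt; apply/orP; left; apply/eqP; congr inf.
    apply/seteqP; split=> [_ [p Sp <-]|_ [p Sp <-]].
      by exists (p.1 + w, p.2) => //=; rewrite subrACA.
    exists (p.1 - w, p.2); first exact: S'S.
    by rewrite /= -[p.1 - w - x]addrA -opprD [w + x]addrC.
  have [p Sp hp] := quasidense_fuzzy0 S' W eta dS' S'0 mS' qS' dW W0 cW convW eta0.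
  by exists (p.1 + w, p.2); split=> //=; rewrite addrK.
(* A positive infimum serves as [eta] for the singleton of [xs], where the distance and the maximum
   become the norm and the pairing. *)
rewrite leNgt; apply/negP => i0.
have dxs1 f : [set xs] f -> is_dual f by move=> ->.
have [p [Sp]] := h x [set xs] dxs1 (ex_intro _ xs erefl)
  (singleton_weakstar_compact xs) (convex_dual_set1 xs) _ i0.
rewrite /ddist !image_set1 inf1 sup1; apply/negP; rewrite -leNgt.
apply: ge_inf; last by exists p.
(* The lower bound 0 ensures that the infimum lies below each of its elements. *)
exists 0 => _ [q Sq <-]; apply: young_dual; apply: is_dual_dsub => //.
exact: HSd.
Qed.
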